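(* Let $D_1,D_2$ be dissection diagrams of positive degrees $n_1,n_2$. Let $i\in\{1,\dots,n_1\}$, $\varrho\in\{0,\dots,f_{D_1}(i)\}$, $p\in\{0,\dots,f_{D_2}(0)\}$; $j,j_1,j_2\in\{1,\dots,n_2\}$; $\tau\in\{0,\dots,f_{D_2}(j)\}$, $\tau_1\in\{0,\dots,f_{D_2}(j_1)\}$, $\tau_2\in\{0,\dots,f_{D_2}(j_2)\}$; $\omega,\omega_1,\omega_2\in\{0,\dots,f_{D_2}(0)\}$; $t,t_1,t_2\in\{0,\dots,f_{D_1}(0)\}$; $\lambda,\lambda_1,\lambda_2\in\{0,1\}$. Assume first $D_1\ne D_2$. Then: 1. $(\Gamma^1_{t_1,j_1,\tau_1}(D_1\otimes D_2),\{j_1,j_1+n_1+1\})=(\Gamma^1_{t_2,j_2,\tau_2}(D_1\otimes D_2),\{j_2,j_2+n_1+1\})$ if and only if $j_1=j_2$, $t_1=t_2$ and $\tau_1=\tau_2$; 2. $(\Gamma^{\lambda_1}_{t_1,\omega_1}(D_1\otimes D_2),\{0,\lambda_1n_1+(1-\lambda_1)n_2+1\})=(\Gamma^{\lambda_2}_{t_2,\omega_2}(D_1\otimes D_2),\{0,\lambda_2n_1+(1-\lambda_2)n_2+1\})$ if and only if $t_1=t_2$, $\omega_1=\omega_2$ and $\lambda_1=\lambda_2$; 3. $(\Gamma^1_{t_1,j_1,\tau_1}(D_1\otimes D_2),\{j_1,j_1+n_1+1\})\ne(\Gamma^{\lambda_2}_{t_2,\omega_2}(D_1\otimes D_2),\{0,\lambda_2n_1+(1-\lambda_2)n_2+1\})$;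 4. $(\Gamma^1_{t,j,\tau}(D_1\otimes D_2),\{j,j+n_1+1\})\ne(\Gamma^1_{p,i,\varrho}(D_2\otimes D_1),\{i,i+n_2+1\})$. Assume now $D_1=D_2=D$ (so $n_1=n_2$). Then: 5. $(\Gamma^1_{t_1,j_1,\tau_1}(D\otimes D),\{j_1,j_1+n_1+1\})=(\Gamma^1_{t_2,j_2,\tau_2}(D\otimes D),\{j_2,j_2+n_1+1\})$ if and only if $j_1=j_2$, $t_1=t_2$ and $\tau_1=\tau_2$; 6. $(\Gamma^{\lambda}_{t,\omega}(D\otimes D),\{0,n_1+1\})=(\Gamma^{1-\lambda}_{\omega,t}(D\otimes D),\{0,n_1+1\})$; 7. $(\Gamma^1_{t_1,j_1,\tau_1}(D\otimes D),\{j_1,j_1+n_1+1\})\ne(\Gamma^{\lambda}_{t_2,\omega_2}(D\otimes D),\{0,n_1+1\})$.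
   Context: Dissection diagrams. For $n\ge 0$ let $\Pi_n$ be the regular $(n+1)$-gon with vertices $0,1,\dots,n$ numbered clockwise; vertex $0$ is the root. A chord $\{u,v\}$ is a segment joining two distinct vertices (adjacent vertices are allowed). A dissection diagram of degree $n$ is a set of $n$ pairwise non-crossing chords (they may share endpoints) of $\Pi_n$ forming an acyclic graph, hence a spanning tree on $\{0,\dots,n\}$. Chords at a vertex. The fertility $f_D(i)$ is the number of chords of $D$ having $i$ as an endpoint. These chords are listed as $a^i_{D,1},\dots,a^i_{D,f_D(i)}$ in the order in which their other endpoints are met in the sequence $i-1,i-2,\dots,0,n,n-1,\dots,i+1$ (for $i=0$: $n,n-1,\dots,1$). ''The first $t$ chords at $i$'' means $a^i_{D,1},\dots,a^i_{D,t}$. Insertion of a chord in two diagrams. Let $D_1,D_2$ have degrees $n_1,n_2\ge1$. All diagrams below are dissection diagrams of degree $n_1+n_2+1$. - For $0\le t\le f_{D_1}(0)$, $1\le j\le n_2$, $0\le\tau\le f_{D_2}(j)$, $\Gamma^1_{t,j,\tau}(D_1\otimes D_2)$ has as chords: $\{j,j+n_1+1\}$; the images of the chords of $D_2$, where an endpoint $u<j$ stays $u$, an endpoint $u>j$ becomes $u+n_1+1$, and the endpoint $j$ stays $j$ for the first $\tau$ chords at $j$ and becomes $j+n_1+1$ for the others; the images of the chords of $D_1$, where an endpoint $v\ge1$ becomes $v+j$ and the endpoint $0$ becomes $j+n_1+1$ for the first $t$ chords at $0$ and $j$ for the others. - For $0\le t\le f_{D_1}(0)$, $0\le\tau\le f_{D_2}(0)$,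 $\Gamma^0_{t,\tau}(D_1\otimes D_2)$ has as chords: $\{0,n_2+1\}$; the images of the chords of $D_2$, where nonzero endpoints are unchanged and the endpoint $0$ becomes $n_2+1$ for the first $\tau$ chords at $0$ and stays $0$ for the others; the images of the chords of $D_1$, where an endpoint $v\ge1$ becomes $v+n_2+1$ and the endpoint $0$ stays $0$ for the first $t$ chords at $0$ and becomes $n_2+1$ for the others. - For the same $t,\tau$, $\Gamma^1_{t,\tau}(D_1\otimes D_2)$ has as chords: $\{0,n_1+1\}$; the images of the chords of $D_1$, where nonzero endpoints are unchanged and the endpoint $0$ becomes $n_1+1$ for the first $t$ chords at $0$ and stays $0$ for the others; the images of the chords of $D_2$, where an endpoint $v\ge1$ becomes $v+n_1+1$ and the endpoint $0$ stays $0$ for the first $\tau$ chords at $0$ and becomes $n_1+1$ for the others. *)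

(* Defs.v *)
From mathcomp Require Import all_boot.
From mathcomp Require Import finmap.

Set Implicit Arguments.
Unset Strict Implicit.
Unset Printing Implicit Defensive.

Local Open Scope fset_scope.
Local Open Scope nat_scope.

(* Vertices are natural numbers and chords are two-element finite sets of
   vertices. The degree of a diagram is not part of the type of the diagram, so
   that diagrams of different degrees can be compared; diagrams are equal when
   they have the same chords. *)
Definition chord := {fset nat}.

Definition is_chord (n : nat) (c : chord) : Prop :=
  exists u v : nat, [/\ u < v, v <= n & c = [fset u; v]].

(* Two chords of a convex polygon cross exactly when their endpoints strictly
   interleave in the cyclic order of the vertices. *)
Definition crossing (c d : chord) : Prop :=
  exists u v x y : nat,
    [/\ c = [fset u; v], d = [fset x; y] &
      (u < x < v) && (v < y) \/ (x < u < y) && (y < v)].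

Definition adjacent (D : {fset chord}) : rel nat :=
  fun u v => [fset u; v] \in D.

(* A simple cycle of a graph visits at least three distinct vertices; [cycle]
   also holds for [:: u; v], which runs back and forth along one chord. *)
Definition acyclic (D : {fset chord}) : Prop :=
  forall s : seq nat, uniq s -> cycle (adjacent D) s -> size s < 3.

Record dissection_diagram (n : nat) (D : {fset chord}) : Prop :=
  DissectionDiagram {
    diagram_chord : forall c, c \in D -> is_chord n c;
    diagram_card : #|` D| = n;
    diagram_noncrossing : forall c d, c \in D -> d \in D -> ~ crossing c d;
    diagram_acyclic : acyclic D
  }.

Definition fertility (D : {fset chord}) (i : nat) : nat :=
  #|` [fset c in D | i \in c] |.

(* The sequence i-1, ..., 0, n, ..., i+1. *)
Definition visit (n i : nat) : seq nat :=
  rev (iota 0 i) ++ rev (iota i.+1 (n - i)).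

Definition chords_at (n : nat) (D : {fset chord}) (i : nat) : seq chord :=
  [seq [fset i; v] | v <- visit n i & [fset i; v] \in D].

Definition first_chords (n : nat) (D : {fset chord}) (i t : nat) : seq chord :=
  take t (chords_at n D i).

Definition Gamma_side (n1 n2 t j tau : nat) (D1 D2 : {fset chord}) :
    {fset chord} :=
  [fset j; j + n1 + 1] |`
  ([fset [fset (if u < j then u
                else if j < u then u + n1 + 1
                else if c \in first_chords n2 D2 j tau then j
                else j + n1 + 1) | u in c] | c in D2] `|`
   [fset [fset (if 1 <= v then v + j
                else if c \in first_chords n1 D1 0 t then j + n1 + 1
                else j) | v in c] | c in D1]).

Definition Gamma_root0 (n1 n2 t tau : nat) (D1 D2 : {fset chord}) :
    {fset chord} :=
  [fset 0; n2 + 1] |`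
  ([fset [fset (if 1 <= v then v
                else if c \in first_chords n2 D2 0 tau then n2 + 1
                else 0) | v in c] | c in D2] `|`
   [fset [fset (if 1 <= v then v + n2 + 1
                else if c \in first_chords n1 D1 0 t then 0
                else n2 + 1) | v in c] | c in D1]).

Definition Gamma_root1 (n1 n2 t tau : nat) (D1 D2 : {fset chord}) :
    {fset chord} :=
  [fset 0; n1 + 1] |`
  ([fset [fset (if 1 <= v then v
                else if c \in first_chords n1 D1 0 t then n1 + 1
                else 0) | v in c] | c in D1] `|`
   [fset [fset (if 1 <= v then v + n1 + 1
                else if c \in first_chords n2 D2 0 tau then 0
                else n1 + 1) | v in c] | c in D2]).

(* The upper index 0 or 1 is a boolean, so that 1 - lambda is [~~ lambda]. *)
Definition Gamma_root (lambda : bool) :=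
  if lambda then Gamma_root1 else Gamma_root0.

(* Main.v *)
Require Import Defs.
From mathcomp Require Import all_boot.
From mathcomp Require Import finmap zify.

Set Implicit Arguments.
Unset Strict Implicit.
Unset Printing Implicit Defensive.

Local Open Scope fset_scope.
Local Open Scope nat_scope.

(** Contracting the distinguished chord undoes the insertion, in the following
sense. Inserting a chord splits one vertex of each of the two diagrams into the
two endpoints of the new chord, and the two diagrams end up on opposite sides of
it. Contract the new chord to a point together with everything on the side of
one diagram: what remains on the other side is exactly the other diagram. So the
pair (diagram, distinguished chord) determines the two diagrams, as soon as the
position and the length of the distinguished chord say which side carries which
diagram. Moreover a chord issued from the split vertex was among the first ones
precisely when its image ends at a prescribed end of the new chord. As the chords
at a vertex are listed without repetition, the set of the first [t] of them
determines [t].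

This is [Gamma_side_inj], obtained by applying [split_diagram_inj] twice, once to
each side. It covers all three insertions, because inserting at the root is the
case [j = 0] of inserting at a side ([Gamma_root1E]), and the root insertion of
index 0 is the one of index 1 with the two diagrams exchanged ([Gamma_root0E]).

All the claims follow. The distinguished chord gives its lower end and, from its
length, the degree of the diagram it encloses ([fset2_gap_inj]). When the same
data come from the two diagrams in both orders, the degrees agree, and the
injectivity gives [D1 = D2]. Conversely, for [D1 = D2] the exchange of the two
diagrams is the symmetry between the two root insertions. *)

(** * Splitting a vertex *)

(** The common shape of all the relabellings in the insertions. The ends [a] and
[b] are those of the inserted chord, in either order: which of them receives the
first chords depends on the diagram. *)
Definition split_chord (i : nat) (f : nat -> nat) (a b : nat) (L : seq chord)
    (c : chord) : chord :=
  [fset (if u == i then if c \in L then a else b else f u) | u in c].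

Definition split_diagram (i : nat) (f : nat -> nat) (a b : nat)
    (L : seq chord) (D : {fset chord}) : {fset chord} :=
  [fset split_chord i f a b L c | c in D].

(** * Chords of a diagram *)

Lemma diagram_vertex n D c u :
  dissection_diagram n D -> c \in D -> u \in c -> u <= n.
Proof.
move=> HD /(diagram_chord HD) [x [y [ltxy leyn ->]]].
by rewrite !inE => /orP[] /eqP->; lia.
Qed.

Lemma diagram_chord_neq0 n D c :
  dissection_diagram n D -> c \in D -> exists u, u \in c.
Proof.
by move=> HD /(diagram_chord HD) [x [y [_ _ ->]]]; exists x; rewrite !inE eqxx.
Qed.

Lemma diagram_chord_neq1 n D c i :
  dissection_diagram n D -> c \in D -> c <> [fset i].
Proof.
move=> HD /(diagram_chord HD) [x [y [ltxy _ ->]]] /(congr1 (fun A => #|` A|)).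
by rewrite cardfs2 cardfs1 neq_ltn ltxy.
Qed.

Lemma chords_at_mem n D i c : c \in chords_at n D i -> (c \in D) && (i \in c).
Proof.
by case/mapP=> v; rewrite mem_filter => /andP[cD _] ->; rewrite cD !inE eqxx.
Qed.

Lemma chords_at_uniq n D i : uniq (chords_at n D i).
Proof.
rewrite map_inj_in_uniq.
  rewrite filter_uniq // cat_uniq !rev_uniq !iota_uniq andbT /=.
  by apply/hasPn => x; rewrite !mem_rev !mem_iota; lia.
move=> x y; rewrite !mem_filter !mem_cat !mem_rev !mem_iota.
move=> /andP[_ xi] /andP[_ yi] /fsetP/(_ x); rewrite !inE eqxx orbT.
by case/esym/orP=> /eqP; lia.
Qed.

(** The other endpoint of a chord at [i] is a vertex of the polygon distinct from
[i], hence it occurs in [visit n i]. *)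
Lemma fertility_chords_at n D i :
  dissection_diagram n D -> fertility D i <= size (chords_at n D i).
Proof.
move=> HD; apply: leq_trans (size_undup _); rewrite -card_fseq.
apply/fsubset_leq_card/fsubsetP => c.
rewrite !inE => /andP[cD ic].
have := cD; have [x [y [ltxy leyn cE]]] := diagram_chord HD cD.
move: ic; rewrite {}cE !inE => /orP[] /eqP-> {}cD; apply/mapP.
  by exists y => //; rewrite mem_filter cD mem_cat !mem_rev !mem_iota; lia.
exists x; last by rewrite fsetUC.
by rewrite mem_filter fsetUC cD mem_cat !mem_rev !mem_iota; lia.
Qed.

Lemma first_chords_inj n D i t t' :
  dissection_diagram n D -> t <= fertility D i -> t' <= fertility D i ->
  {in D, forall c, i \in c ->
     (c \in first_chords n D i t) = (c \in first_chords n D i t')} ->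
  t = t'.
Proof.
move=> HD le_t le_t' eqL; have lef := fertility_chords_at i HD.
have subL s c : c \in first_chords n D i s -> (c \in D) && (i \in c).
  by move/mem_take/chords_at_mem.
have /(uniq_size_uniq (take_uniq t (chords_at_uniq n D i))) :
    first_chords n D i t =i first_chords n D i t'.
  move=> c; apply/idP/idP => cL; have /andP[cD ic] := subL _ _ cL.
    by rewrite -eqL.
  by rewrite eqL.
rewrite take_uniq ?chords_at_uniq // !size_takel ?(leq_trans _ lef) //.
by move/esym/eqP.
Qed.

(** * Contracting the distinguished chord *)

Section Collapse.

Variables (n i a b : nat) (f g : nat -> nat).
Hypothesis neq_ab : a != b.
Hypotheses (ga : g a = i) (gb : g b = i).
Hypothesis fK : forall u, u <= n -> u != i -> g (f u) = u.

(** The contraction [g] sends both ends [a] and [b] back to the split vertex, so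
the way in which the chords at [i] were shared out is forgotten. *)
Lemma collapse_split_chord L (c : chord) :
  (forall u, u \in c -> u <= n) -> g @` (split_chord i f a b L c) = c.
Proof.
move=> lecn.
have gE u : u \in c ->
    g (if u == i then if c \in L then a else b else f u) = u.
  move=> uc; have [->|ui] := eqVneq u i; first by case: ifP.
  by apply: fK => //; apply: lecn.
apply/fsetP => v; apply/imfsetP/idP => /= [[_ /imfsetP[u /= uc ->] ->]|vc].
  by rewrite gE.
exists (if v == i then if c \in L then a else b else f v); last by rewrite gE.
by apply/imfsetP; exists v.
Qed.

(** Conversely, the end [a] remembers [L]: no vertex other than [i] can be moved
to [a], since [g] would then send it both to itself and to [i]. *)
Lemma split_chord_end L (c : chord) :
  (forall u, u \in c -> u <= n) -> i \in c ->
  (a \in split_chord i f a b L c) = (c \in L).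
Proof.
move=> lecn ic; apply/imfsetP/idP => /= [[u uc]|cL]; last first.
  by exists i => //; rewrite eqxx cL.
have [_|ui aE] := eqVneq u i.
  by case: ifP => // _ /eqP; rewrite (negPf neq_ab).
by move: (ui); rewrite -[u in u != _]fK ?lecn // -aE ga eqxx.
Qed.

(** [X'] stands for the part of the glued diagram that the contraction crushes:
a chord of [D] has two distinct endpoints, hence its image cannot hide in
[X'], and it must come from a chord of [D'] with the same contraction. *)
Lemma sub_split_diagram L L' D D' (X' : {fset chord}) :
  dissection_diagram n D -> dissection_diagram n D' ->
  {in X', forall c : chord, g @` c = [fset i]} ->
  split_diagram i f a b L D `<=` X' `|` split_diagram i f a b L' D' ->
  {in D, forall c, c \in D' /\ (i \in c -> (c \in L) = (c \in L'))}.
Proof.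
move=> HD HD' gX' /fsubsetP sub c cD.
have lec u : u \in c -> u <= n by apply: diagram_vertex HD cD.
have /sub : split_chord i f a b L c \in split_diagram i f a b L D.
  by apply/imfsetP; exists c.
rewrite in_fsetU => /orP[/gX'|/imfsetP[c' /= c'D' eqc]].
  by rewrite collapse_split_chord // => /(diagram_chord_neq1 HD cD).
have lec' u : u \in c' -> u <= n by apply: diagram_vertex HD' c'D'.
have eqcc' : c = c'.
  by rewrite -(collapse_split_chord L lec) eqc collapse_split_chord.
subst c'; split=> // ic.
by rewrite -(split_chord_end L lec ic) eqc split_chord_end.
Qed.

Lemma split_diagram_inj L L' D D' (X X' : {fset chord}) :
  dissection_diagram n D -> dissection_diagram n D' ->
  {in X, forall c : chord, g @` c = [fset i]} ->
  {in X', forall c : chord, g @` c = [fset i]} ->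
  X `|` split_diagram i f a b L D = X' `|` split_diagram i f a b L' D' ->
  D = D' /\ {in D, forall c, i \in c -> (c \in L) = (c \in L')}.
Proof.
move=> HD HD' gX gX' eqG.
have sub : {in D, forall c, c \in D' /\ (i \in c -> (c \in L) = (c \in L'))}.
  by apply: sub_split_diagram gX' _ => //; rewrite -eqG fsubsetUr.
have sub' : {in D', forall c, c \in D /\ (i \in c -> (c \in L') = (c \in L))}.
  by apply: sub_split_diagram gX _ => //; rewrite eqG fsubsetUr.
split; last by move=> c /sub[].
by apply/fsetP => c; apply/idP/idP => [/sub[]|/sub'[]].
Qed.

End Collapse.

(** * Inserted chords determine the two diagrams *)

Definition outer_vertex (n1 j u : nat) : nat := if u < j then u else u + n1 + 1.

(** The two contractions of the chord [{j, j + n1 + 1}]: the first one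
crushes everything outside the open interval enclosed by the chord to the root of
the inner diagram, the second one crushes the interval to the vertex [j] of
the outer diagram. *)
Definition inner_collapse (n1 j x : nat) : nat :=
  if j < x <= j + n1 then x - j else 0.

Definition outer_collapse (n1 j x : nat) : nat :=
  if x < j then x else if x <= j + n1 + 1 then j else x - (n1 + 1).

Lemma Gamma_sideE n1 n2 t j tau D1 D2 :
  Gamma_side n1 n2 t j tau D1 D2 =
  [fset j; j + n1 + 1] |`
  (split_diagram j (outer_vertex n1 j) j (j + n1 + 1) (first_chords n2 D2 j tau)
     D2 `|`
   split_diagram 0 (addn^~ j) (j + n1 + 1) j (first_chords n1 D1 0 t) D1).
Proof.
congr (_ |` (_ `|` _)); apply: eq_imfset => // c; apply: eq_imfset => // u.
  by rewrite /outer_vertex; case: (ltngtP u j).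
by case: u.
Qed.

Lemma imfset_const (A : {fset nat}) (g : nat -> nat) i u :
  u \in A -> (forall x, x \in A -> g x = i) -> g @` A = [fset i].
Proof.
move=> uA gA; apply/fsetP => v; rewrite inE.
apply/imfsetP/eqP => /= [[x xA ->]|->]; first exact: gA.
by exists u; rewrite ?gA.
Qed.

(** Provides the crushed part required by [split_diagram_inj]: from the point of
view of one diagram, the distinguished chord and the other diagram contract to
a single vertex. *)
Lemma collapse_split_diagram_const i f a b L n D (g : nat -> nat) k :
  dissection_diagram n D -> g a = k -> g b = k ->
  (forall u, u <= n -> u != i -> g (f u) = k) ->
  {in [fset a; b] |` split_diagram i f a b L D,
     forall c : chord, g @` c = [fset k]}.
Proof.
move=> HD ga gb gf _ /fset1UP[->|/imfsetP[c /= cD ->]].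
  apply: (@imfset_const _ _ _ a); first by rewrite !inE eqxx.
  by move=> x; rewrite !inE => /orP[] /eqP->.
have [u uc] := diagram_chord_neq0 HD cD.
apply: imfset_const; first by apply/imfsetP; exists u.
move=> _ /imfsetP[v /= vc ->]; case: ifP => [_|/negbT vi]; first by case: ifP.
by apply: gf => //; apply: diagram_vertex HD cD vc.
Qed.

Lemma Gamma_side_inj n1 n2 j t t' tau tau' D1 D1' D2 D2' :
  dissection_diagram n1 D1 -> dissection_diagram n1 D1' ->
  dissection_diagram n2 D2 -> dissection_diagram n2 D2' ->
  Gamma_side n1 n2 t j tau D1 D2 = Gamma_side n1 n2 t' j tau' D1' D2' ->
  [/\ D1 = D1', D2 = D2',
      t <= fertility D1 0 -> t' <= fertility D1 0 -> t = t' &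
      tau <= fertility D2 j -> tau' <= fertility D2 j -> tau = tau'].
Proof.
move=> HD1 HD1' HD2 HD2'; rewrite !Gamma_sideE => eqG.
have neq_ab : j != j + n1 + 1 by lia.
have [D1E eqL1] : D1 = D1' /\ {in D1, forall c, 0 \in c ->
    (c \in first_chords n1 D1 0 t) = (c \in first_chords n1 D1' 0 t')}.
  (* The inner diagram [D1], with the chord and [D2] crushed to its root. *)
  move: eqG; rewrite !fsetUA; have neq_ba : j + n1 + 1 != j by rewrite eq_sym.
  apply: (split_diagram_inj (n := n1) (g := inner_collapse n1 j) neq_ba) => //;
    rewrite /inner_collapse.
  - by case: ifP => //; lia.
  - by case: ifP => //; lia.
  - by move=> u leun u0; case: ifP; lia.
  - apply: collapse_split_diagram_const HD2 _ _ _ => [||u _ uj];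
      rewrite /outer_vertex; do ![case: ifP]; lia.
  - apply: collapse_split_diagram_const HD2' _ _ _ => [||u _ uj];
      rewrite /outer_vertex; do ![case: ifP]; lia.
have [D2E eqL2] : D2 = D2' /\ {in D2, forall c, j \in c ->
    (c \in first_chords n2 D2 j tau) = (c \in first_chords n2 D2' j tau')}.
  (* The outer diagram [D2], with the chord and [D1] crushed to [j]. *)
  move: eqG; rewrite !fsetUA ![_ `|` _ `|` split_diagram 0 _ _ _ _ _]fsetUAC.
  apply: (split_diagram_inj (n := n2) (g := outer_collapse n1 j) neq_ab) => //;
    rewrite /outer_collapse.
  - by do ![case: ifP]; lia.
  - by do ![case: ifP]; lia.
  - by move=> u _ uj; rewrite /outer_vertex; do ![case: ifP]; lia.
  - rewrite (fsetUC [fset j]).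
    apply: collapse_split_diagram_const HD1 _ _ _ => [||u leu u0];
      do ![case: ifP]; lia.
  - rewrite (fsetUC [fset j]).
    apply: collapse_split_diagram_const HD1' _ _ _ => [||u leu u0];
      do ![case: ifP]; lia.
subst D1' D2'; split=> // le_t le_t'.
  exact: first_chords_inj HD1 le_t le_t' eqL1.
exact: first_chords_inj HD2 le_t le_t' eqL2.
Qed.

(** * Comparing the insertions *)

Lemma fset2_gap_inj j n i m :
  [fset j; j + n + 1] = [fset i; i + m + 1] -> j = i /\ n = m.
Proof.
move=> /fsetP eqc; move: (eqc j) (eqc i) (eqc (j + n + 1)) (eqc (i + m + 1)).
by rewrite !inE !eqxx !orbT /=; lia.
Qed.

(** For [j = 0] no vertex of the second diagram lies before [j], so that the side
insertion shifts all its nonzero vertices, as the root insertion does. *)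
Lemma Gamma_root1E n1 n2 t tau D1 D2 :
  Gamma_root1 n1 n2 t tau D1 D2 = Gamma_side n1 n2 t 0 tau D1 D2.
Proof.
rewrite /Gamma_root1 /Gamma_side [X in _ |` X]fsetUC.
congr (_ |` (_ `|` _)); apply: eq_imfset => // c; apply: eq_imfset => // -[|v] //=.
by rewrite addn0.
Qed.

Lemma Gamma_root0E n1 n2 t tau D1 D2 :
  Gamma_root0 n1 n2 t tau D1 D2 = Gamma_side n2 n1 tau 0 t D2 D1.
Proof. by rewrite -Gamma_root1E. Qed.

Theorem proposition43 (n1 n2 : nat) (D1 D2 : {fset chord})
  (n1_gt0 : 0 < n1) (n2_gt0 : 0 < n2)
  (HD1 : dissection_diagram n1 D1) (HD2 : dissection_diagram n2 D2)
  (i rho p : nat) (Hi : 1 <= i <= n1) (Hrho : rho <= fertility D1 i)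
  (Hp : p <= fertility D2 0)
  (j j1 j2 : nat)
  (Hj : 1 <= j <= n2) (Hj1 : 1 <= j1 <= n2) (Hj2 : 1 <= j2 <= n2)
  (tau tau1 tau2 : nat)
  (Htau : tau <= fertility D2 j)
  (Htau1 : tau1 <= fertility D2 j1) (Htau2 : tau2 <= fertility D2 j2)
  (omega omega1 omega2 : nat)
  (Homega : omega <= fertility D2 0)
  (Homega1 : omega1 <= fertility D2 0) (Homega2 : omega2 <= fertility D2 0)
  (t t1 t2 : nat)
  (Ht : t <= fertility D1 0)
  (Ht1 : t1 <= fertility D1 0) (Ht2 : t2 <= fertility D1 0)
  (lambda lambda1 lambda2 : bool) :
  (D1 <> D2 ->
    [/\ (Gamma_side n1 n2 t1 j1 tau1 D1 D2, [fset j1; j1 + n1 + 1]) =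
        (Gamma_side n1 n2 t2 j2 tau2 D1 D2, [fset j2; j2 + n1 + 1]) <->
        [/\ j1 = j2, t1 = t2 & tau1 = tau2],
        (Gamma_root lambda1 n1 n2 t1 omega1 D1 D2,
           [fset 0; lambda1 * n1 + (1 - lambda1) * n2 + 1]) =
        (Gamma_root lambda2 n1 n2 t2 omega2 D1 D2,
           [fset 0; lambda2 * n1 + (1 - lambda2) * n2 + 1]) <->
        [/\ t1 = t2, omega1 = omega2 & lambda1 = lambda2],
        (Gamma_side n1 n2 t1 j1 tau1 D1 D2, [fset j1; j1 + n1 + 1]) <>
        (Gamma_root lambda2 n1 n2 t2 omega2 D1 D2,
           [fset 0; lambda2 * n1 + (1 - lambda2) * n2 + 1]) &
        (Gamma_side n1 n2 t j tau D1 D2, [fset j; j + n1 + 1]) <>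
        (Gamma_side n2 n1 p i rho D2 D1, [fset i; i + n2 + 1])]) /\
  (forall D : {fset chord}, D1 = D -> D2 = D ->
    [/\ (Gamma_side n1 n2 t1 j1 tau1 D D, [fset j1; j1 + n1 + 1]) =
        (Gamma_side n1 n2 t2 j2 tau2 D D, [fset j2; j2 + n1 + 1]) <->
        [/\ j1 = j2, t1 = t2 & tau1 = tau2],
        (Gamma_root lambda n1 n2 t omega D D, [fset 0; n1 + 1]) =
        (Gamma_root (~~ lambda) n1 n2 omega t D D, [fset 0; n1 + 1]) &
        (Gamma_side n1 n2 t1 j1 tau1 D D, [fset j1; j1 + n1 + 1]) <>
        (Gamma_root lambda n1 n2 t2 omega2 D D, [fset 0; n1 + 1])]).
Proof.
have eq_gap : [fset 0; n1 + 1] = [fset 0; n2 + 1] -> n1 = n2.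
  by move=> eqc; have [] := @fset2_gap_inj 0 n1 0 n2 eqc.
have side_inj : (Gamma_side n1 n2 t1 j1 tau1 D1 D2, [fset j1; j1 + n1 + 1]) =
    (Gamma_side n1 n2 t2 j2 tau2 D1 D2, [fset j2; j2 + n1 + 1]) <->
    [/\ j1 = j2, t1 = t2 & tau1 = tau2].
  split=> [[eqG /fset2_gap_inj[eqj _]]|[-> -> ->] //]; subst j2.
  by have [_ _ eqt eqtau] := Gamma_side_inj HD1 HD1 HD2 HD2 eqG; split; auto.
have side_root (G G' : {fset chord}) m :
    (G, [fset j1; j1 + n1 + 1]) <> (G', [fset 0; m + 1]).
  by case=> _ /(@fset2_gap_inj j1 n1 0 m)[eqj _]; rewrite eqj in Hj1.
split=> [neqD|D eqD1 eqD2].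
  split=> //.
  - split=> [[]|[-> -> ->] //].
    case: lambda1; case: lambda2;
      rewrite /= !(mul0n, mul1n, subn0, subnn, addn0, add0n)
        ?Gamma_root1E ?Gamma_root0E => eqG eqc.
    + by have [_ _ eqt eqom] := Gamma_side_inj HD1 HD1 HD2 HD2 eqG; split; auto.
    (* Equal lengths of the distinguished chord force [n1 = n2], after which
       the inner diagrams of both sides, [D1] and [D2], must coincide. *)
    + have eqn := eq_gap eqc; subst n2.
      by have [/neqD] := Gamma_side_inj HD1 HD2 HD2 HD1 eqG.
    + have eqn := eq_gap (esym eqc); subst n2.
      by have [/esym/neqD] := Gamma_side_inj HD2 HD1 HD1 HD2 eqG.
    + by have [_ _ eqom eqt] := Gamma_side_inj HD2 HD2 HD1 HD1 eqG; split; auto.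
  - case=> eqG /fset2_gap_inj[eqj eqn]; subst i n2.
    by have [/neqD] := Gamma_side_inj HD1 HD2 HD2 HD1 eqG.
have eqn : n1 = n2 by rewrite -(diagram_card HD1) -(diagram_card HD2) eqD1 eqD2.
subst D1 D2 n2; split=> //.
by case: lambda; rewrite /= Gamma_root1E Gamma_root0E.
Qed.
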